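(* Let $A$ be a finite set of vectors in $\mathbb R_\infty^n$. Then $A^{\perp\perp}$ is the minimal (with respect to the subset relation) tropical linear prevariety containing $A$.
   Context: $\mathbb R_\infty=\mathbb R\cup\{\infty\}$, with $a<\infty$ and $a+\infty=\infty$ for $a\in\mathbb R$, and $\infty+\infty=\infty$. Vectors $\mathbf v,\mathbf a\in\mathbb R_\infty^n$ are tropically orthogonal if among $v_1+a_1,\dots,v_n+a_n$ at least two are minimal (the minimum is attained for at least two indices; in particular $(\infty,\dots,\infty)$ is tropically orthogonal to every vector). For $X\subset\mathbb R_\infty^n$ (not necessarily finite), $X^\perp$ is the set of all vectors in $\mathbb R_\infty^n$ tropically orthogonal to every element of $X$, and $X^{\perp\perp}=(X^\perp)^\perp$. A tropical hyperplane in $\mathbb R_\infty^n$ is a set of the form $\{\mathbf a\}^\perp$ with $\mathbf a\in\mathbb R_\infty^n$; a tropical linear prevariety is an intersection of finitely many tropical hyperplanes, i.e. a set of the form $B^\perp$ with $B\subset\mathbb R_\infty^n$ finite. *)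

(* Defs.v *)
From mathcomp Require Import all_boot all_order all_algebra.
From mathcomp Require Import all_classical all_reals.

Set Implicit Arguments.
Unset Strict Implicit.
Unset Printing Implicit Defensive.

Local Open Scope classical_set_scope.

(* R with a top element: order and addition are those of \bar R. *)
Definition Rinf (R : realType) := {x : \bar R | x != -oo%E}.

Definition Rinf_vec (R : realType) (n : nat) := 'I_n -> Rinf R.

(* For n <= 1 no two vectors are orthogonal, not even when one of them is
   (oo, ..., oo). *)
Definition trop_orth (R : realType) (n : nat) (v a : Rinf_vec R n) : Prop :=
  let s i := (\val (v i) + \val (a i))%E in
  exists i j : 'I_n,
    [/\ i != j, forall k, (s i <= s k)%E & forall k, (s j <= s k)%E].

Definition trop_perp (R : realType) (n : nat) (X : set (Rinf_vec R n)) :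
    set (Rinf_vec R n) :=
  [set v | forall x, X x -> trop_orth v x].

Definition trop_hyperplane (R : realType) (n : nat) (a : Rinf_vec R n) :
    set (Rinf_vec R n) :=
  trop_perp [set a].

(* The empty intersection (B = set0) is the whole space. *)
Definition trop_prevariety (R : realType) (n : nat) (P : set (Rinf_vec R n)) :
    Prop :=
  exists2 B : set (Rinf_vec R n),
    finite_set B & P = \bigcap_(b in B) trop_hyperplane b.

(* Main.v *)
Require Import Defs.
From mathcomp Require Import all_boot all_order all_algebra.
From mathcomp Require Import all_classical all_reals.
From mathcomp Require Import lra.
Import Order.TTheory GRing.Theory Num.Theory.
Local Open Scope classical_set_scope.

(** Double orthogonals are prevarieties because [trop_perp A] is a finitely
    generated tropical module, and orthogonality to generators implies
    orthogonality to everything they generate.  The orthogonal of [a] is the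
    intersection over [i] of the halfspaces
    [exists j != i, a_j + x_j <= a_i + x_i], and finite generation survives
    intersection with such a halfspace by a tropical Fourier-Motzkin (double
    description) step: keep the generators lying in the halfspace and add, for
    pairs of generators, the tropical combination lying on its boundary. *)

Section Rinf_operations.
Variables (R : realType) (n : nat).
Implicit Types (x y : Rinf R) (v w a b : Rinf_vec R n).

Lemma Rinf_cases x : \val x = +oo%E \/ exists r : R, \val x = r%:E.
Proof. by have := valP x; case: (\val x) => [r| |] // _; [right; exists r | left]. Qed.

Definition Rinf_of {r : \bar R} (h : r != -oo%E) : Rinf R :=
  exist (fun z => z != -oo%E) r h.

Lemma Rinf_add_subproof x y : (\val x + \val y)%E != -oo%E.
Proof. by case: (Rinf_cases x) => [->|[r ->]]; case: (Rinf_cases y) => [->|[s ->]]. Qed.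

Definition Rinf_add x y : Rinf R := Rinf_of (Rinf_add_subproof x y).

Lemma Rinf_min_subproof x y : Order.min (\val x) (\val y) != -oo%E.
Proof. by case: (leP (\val x) (\val y)) => _; [exact: (valP x) | exact: (valP y)]. Qed.

Definition Rinf_min x y : Rinf R := Rinf_of (Rinf_min_subproof x y).

Lemma EFin_addr_minr (r : R) : {morph (fun u => (r%:E + u)%E) : u v / Order.min u v}.
Proof.
move=> u v; have [uv|/ltW vu] := leP u v; first by rewrite min_l// leeD2l.
by rewrite min_r// leeD2l.
Qed.

Definition trop_comb (l : Rinf R) v (m : Rinf R) w : Rinf_vec R n :=
  fun k => Rinf_min (Rinf_add l (v k)) (Rinf_add m (w k)).

Definition trop_unit (c : 'I_n) : Rinf_vec R n :=
  fun k => if k == c then @Rinf_of 0%E isT else @Rinf_of +oo%E isT.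

Definition trop_halfspace (a : Rinf_vec R n) (i : 'I_n) : set (Rinf_vec R n) :=
  [set v | exists2 j, j != i & (\val (v j) + \val (a j) <= \val (v i) + \val (a i))%E].

Lemma trop_orthC v w : trop_orth v w -> trop_orth w v.
Proof.
move=> [i [j [ij mi mj]]]; exists i, j; split=> // k.
  by rewrite ![(\val (w _) + _)%E]addeC.
by rewrite ![(\val (w _) + _)%E]addeC.
Qed.

Lemma trop_orth_halfspace v a :
  (0 < n)%N -> trop_orth v a <-> forall i, trop_halfspace a i v.
Proof.
move=> n0; split=> [[p [q [pq mp mq]]] i|H].
  have [pi|pi] := eqVneq p i; last by exists p.
  by exists q => //; rewrite -pi eq_sym.
pose s k := (\val (v k) + \val (a k))%E.
case: (@arg_minP _ _ _ (Ordinal n0) xpredT s erefl) => i _ mi.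
have [j ji le_ji] := H i.
exists i, j; split; first by rewrite eq_sym.
  by move=> k; exact: mi.
by move=> k; apply: le_trans le_ji _; exact: mi.
Qed.

(* [B] generates [K] as a tropical module; each coordinate of [x] is attained
   by some multiple of a generator lying above [x], so [x] is the tropical sum
   of these multiples. *)
Definition trop_gen (B K : set (Rinf_vec R n)) :=
  forall v, K v -> forall c, \val (v c) != +oo%E ->
    exists2 b, B b & exists2 l : R,
      forall k, (\val (v k) <= l%:E + \val (b k))%E
      & \val (v c) = (l%:E + \val (b c))%E.

Definition trop_closed (K : set (Rinf_vec R n)) :=
  forall l v m w, K v -> K w -> K (trop_comb l v m w).

Lemma trop_halfspace_closed a i : trop_closed (trop_halfspace a i).
Proof.
move=> l v m w [j ji vj] [k ki wk].
rewrite /trop_halfspace /=.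
case: (leP (\val l + \val (v i))%E (\val m + \val (w i))%E) => h.
  exists j => //; rewrite -addeA.
  apply: le_trans (leeD2l _ vj); rewrite addeA.
  by apply: leeD2r; rewrite ge_min lexx.
exists k => //; rewrite -addeA.
apply: le_trans (leeD2l _ wk); rewrite addeA.
by apply: leeD2r; rewrite ge_min lexx orbT.
Qed.

Lemma trop_comb_halfspace a (i j : 'I_n) v w : j != i ->
  (\val (v j) + \val (a j) <= \val (v i) + \val (a i))%E ->
  trop_halfspace a i
    (trop_comb (Rinf_add (w i) (a i)) v (Rinf_add (v j) (a j)) w).
Proof.
move=> ji h; exists j => //=.
apply: (@le_trans _ _ ((\val (w i) + \val (a i)) + (\val (v j) + \val (a j)))%E).
  by rewrite [leRHS]addeA; apply: leeD2r; rewrite ge_min lexx.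
case: (leP (\val (w i) + \val (a i) + \val (v i))%E) => _.
  by rewrite -[leRHS]addeA leeD2l.
by rewrite -[leRHS]addeA [leRHS]addeC.
Qed.

Lemma trop_gen_halfspace a i (B K : set (Rinf_vec R n)) :
  trop_closed K -> finite_set B -> B `<=` K -> trop_gen B K ->
  exists B', [/\ finite_set B', B' `<=` K `&` trop_halfspace a i
                & trop_gen B' (K `&` trop_halfspace a i)].
Proof.
move=> Kcl finB BK genB.
pose comb (p : (Rinf_vec R n * Rinf_vec R n) * 'I_n) :=
  let: (v, w, j) := p in
  trop_comb (Rinf_add (w i) (a i)) v (Rinf_add (v j) (a j)) w.
exists ((B `|` comb @` ((B `*` B) `*` setT)) `&` trop_halfspace a i); split.
- apply: finite_setIl; rewrite finite_setU; split=> //.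
  by apply/finite_image/finite_setX => //; apply: finite_setX.
- move=> u [[Bu|[[[v w] j] [[/= Bv Bw] _] <-]] Hu]; first by split=> //; exact: BK.
  by split=> //; apply: Kcl; exact: BK.
move=> v [Kv [j ji vj]] c vc.
have [b Bb [l lb bc]] := genB v Kv c vc.
have [Hb|nHb] := pselect (trop_halfspace a i b).
  by exists b; [split=> //; left | exists l].
have {nHb} bji : (\val (b i) + \val (a i) < \val (b j) + \val (a j))%E.
  by rewrite ltNge; apply/negP => h; apply: nHb; exists j.
have [bio|[bi Ebi]] := Rinf_cases (b i).
  by move: bji; rewrite bio; case: (Rinf_cases (a i)) => [->|[? ->]] /=;
    rewrite ?addye// ltNge leey.
have [aio|[ai Eai]] := Rinf_cases (a i).
  by move: bji; rewrite aio Ebi addey// ltNge leey.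
have [vio|[vi Evi]] := Rinf_cases (v i); first by have := lb i; rewrite vio Ebi.
have [ajo|[aj Eaj]] := Rinf_cases (a j).
  by move: vj; rewrite ajo Evi Eai addey//; exact: (valP (v j)).
have [vjo|[vj' Evj]] := Rinf_cases (v j); first by move: vj; rewrite vjo Eaj Evi Eai.
have /(genB v Kv)[b' Bb' [l' lb' bj']] : \val (v j) != +oo%E by rewrite Evj.
have [bjo|[bj Ebj]] := Rinf_cases (b' j); first by move: bj'; rewrite bjo Evj.
move: vj bj' (lb i); rewrite Evj Eaj Evi Eai Ebj Ebi -!EFinD !lee_fin.
move=> vji [] Evj' lei.
have b'ji : (\val (b' j) + \val (a j) <= \val (b' i) + \val (a i))%E.
  move: (lb' i); rewrite Ebj Eaj Eai Evi.
  have [->|[r ->]] := Rinf_cases (b' i); first by move=> _; rewrite addye// leey.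
  by rewrite -!EFinD !lee_fin => ?; lra.
have combE k : ((l - (bj + aj))%:E + \val (comb (b', b, j) k) =
    Order.min ((l - (bj + aj) + (bi + ai))%:E + \val (b' k))
              (l%:E + \val (b k)))%E.
  rewrite /= Ebi Eai Ebj Eaj -!EFinD EFin_addr_minr !addeA -!EFinD.
  by congr (Order.min _ (_%:E + _)%E); lra.
have combge k : (\val (v k) <= (l - (bj + aj))%:E + \val (comb (b', b, j) k))%E.
  rewrite combE le_min lb andbT; apply: le_trans (lb' k) _.
  by apply: leeD2r; rewrite lee_fin; lra.
exists (comb (b', b, j)).
  split; last exact: trop_comb_halfspace.
  by right; exists (b', b, j).
exists (l - (bj + aj))%R => //.
by apply/eqP; rewrite eq_le combge combE bc ge_min lexx orbT.
Qed.

Lemma trop_gen_setT : trop_gen (range trop_unit) setT.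
Proof.
move=> v _ c; case: (Rinf_cases (v c)) => [->//|[r Er]] _.
exists (trop_unit c); first by exists c.
exists r; last by rewrite /trop_unit eqxx Er /= adde0.
move=> k; rewrite /trop_unit; case: eqP => [->|_] /=; first by rewrite Er adde0.
by rewrite addey// leey.
Qed.

Lemma trop_halfspaces_gen (s : seq (Rinf_vec R n * 'I_n)) :
  exists B, [/\ finite_set B,
    B `<=` [set v | forall p, p \in s -> trop_halfspace p.1 p.2 v]
  & trop_gen B [set v | forall p, p \in s -> trop_halfspace p.1 p.2 v]].
Proof.
elim: s => [|[a i] s [B [finB BK genB]]].
  exists (range trop_unit); split=> //.
    exact/finite_image/finite_finset.
  by move=> v _; exact: trop_gen_setT.
set K := (X in trop_gen B X) in genB BK.
have Kcl : trop_closed K.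
  by move=> l v m w Kv Kw p ps; apply: trop_halfspace_closed; [exact: Kv | exact: Kw].
have -> : [set v | forall p, p \in (a, i) :: s -> trop_halfspace p.1 p.2 v] =
    K `&` trop_halfspace a i.
  apply/seteqP; split=> v.
    move=> H; split; last by apply: (H (a, i)); rewrite mem_head.
    by move=> p ps; apply: H; rewrite in_cons ps orbT.
  by move=> [Kv Hv] p; rewrite in_cons => /predU1P[->//|]; exact: Kv.
exact: (trop_gen_halfspace _ _ _ _ Kcl finB BK genB).
Qed.

Lemma trop_perp_gen (A : set (Rinf_vec R n)) : (0 < n)%N -> finite_set A ->
  exists B, [/\ finite_set B, B `<=` trop_perp A & trop_gen B (trop_perp A)].
Proof.
move=> n0 /finite_seqP[s ->].
have [B] := trop_halfspaces_gen [seq (a, i) | a <- s, i <- enum 'I_n].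
suff -> : [set v | forall p, p \in [seq (a, i) | a <- s, i <- enum 'I_n] ->
    trop_halfspace p.1 p.2 v] = trop_perp [set` s] by exists B.
apply/seteqP; split=> v H.
  move=> a sa; apply/trop_orth_halfspace => // i.
  by apply: (H (a, i)); rewrite allpairs_f// mem_enum.
move=> p /allpairsP[[a i] [/= sa _ ->]].
by have /trop_orth_halfspace := H _ sa; apply.
Qed.

Lemma trop_perp_trop_gen (B K : set (Rinf_vec R n)) : (1 < n)%N ->
  trop_gen B K -> trop_perp B `<=` trop_perp K.
Proof.
move=> n1 genB v Bv x Kx; have n0 := ltnW n1.
apply/trop_orth_halfspace => // i.
have [xi|xi] := eqVneq (\val (x i)) +oo%E.
  have [j ji] : exists j : 'I_n, j != i.
    have [->|i0] := eqVneq i (Ordinal n0); first by exists (Ordinal n1).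
    by exists (Ordinal n0); rewrite eq_sym.
  by exists j; rewrite // xi addey ?leey//; exact: (valP (v i)).
have [b Bb [l lb bi]] := genB x Kx i xi.
have /trop_orth_halfspace-/(_ n0 i)[j ji h] := Bv b Bb.
exists j => //; rewrite bi addeCA.
apply: le_trans (leeD2l _ h); rewrite addeCA.
by apply: leeD2l.
Qed.

Lemma trop_prevariety_perp (B : set (Rinf_vec R n)) :
  finite_set B -> trop_prevariety (trop_perp B).
Proof.
move=> finB; exists B => //; apply/seteqP; split=> v H b Bb.
  by move=> _ ->; exact: H.
exact: (H b Bb b).
Qed.

Lemma trop_perp_antimono (X Y : set (Rinf_vec R n)) :
  X `<=` Y -> trop_perp Y `<=` trop_perp X.
Proof. by move=> XY v Yv x /XY; exact: Yv. Qed.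

Lemma trop_orth_dim v w : trop_orth v w -> (1 < n)%N.
Proof.
move=> [i [j [ij _ _]]]; rewrite ltnNge; apply/negP => n1; move/eqP: ij; apply.
apply/val_inj => /=; have := ltn_ord i; have := ltn_ord j.
by case: n n1 i j => [|[|]]// _ i j; case: (val i) (val j) => [|?] [|?].
Qed.

Lemma trop_prevariety_biperp (A : set (Rinf_vec R n)) :
  finite_set A -> trop_prevariety (trop_perp (trop_perp A)).
Proof.
move=> finA; have [n1|n1] := ltnP 1 n.
  have [B [finB BK genB]] := trop_perp_gen _ (ltnW n1) finA.
  have -> : trop_perp (trop_perp A) = trop_perp B; last exact: trop_prevariety_perp.
  apply/seteqP; split; first exact: trop_perp_antimono.
  exact: trop_perp_trop_gen.
have perp0 (X : set (Rinf_vec R n)) : X !=set0 -> trop_perp X = set0.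
  by move=> [x Xx]; apply/seteqP; split=> // v /(_ x Xx) /trop_orth_dim; rewrite ltnNge n1.
have [->|/set0P A0] := eqVneq A set0.
  pose u : Rinf_vec R n := fun=> @Rinf_of 0%E isT.
  rewrite perp0; last by exists u.
  by rewrite -(perp0 [set u]); [exact: trop_prevariety_perp | exists u].
by rewrite (perp0 A) //; exact: trop_prevariety_perp.
Qed.

End Rinf_operations.

Theorem proposition1p10 (R : realType) (n : nat) (A : set (Rinf_vec R n))
    (finA : finite_set A) :
  [/\ trop_prevariety (trop_perp (trop_perp A)),
      A `<=` trop_perp (trop_perp A)
    & forall P : set (Rinf_vec R n),
        trop_prevariety P -> A `<=` P -> trop_perp (trop_perp A) `<=` P].
Proof.
split; first exact: trop_prevariety_biperp.
  by move=> v Av x /(_ v Av) /trop_orthC.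
move=> _ [B _ ->] AB v Av b Bb _ ->; apply: Av => a Aa.
exact/trop_orthC/(AB a Aa b Bb b).
Qed.
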